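(* Let $P=(P_s)_{s\in\mathbb{Z}}$ be a sequence of stochastic matrices on $[n]=\{1,\dots,n\}$ such that the target distributions $\pi_t$ exist for all $t\in\mathbb{Z}$. Assume $P_s(x,x)\ge\frac12$ for all $s\in\mathbb{Z}$ and $x\in[n]$, and that for every $x\in[n]$ there is $s<0$ with $\pi_s(x)>0$. Fix $\varepsilon \in (0,1)$. If for some integer $t > 0$ $$\frac{1}{\sqrt{\pi^\mathrm{min}_t \pi^\mathrm{min}_0}} \prod_{s = 1}^{t} \left[1 - \frac{1}{2}\left(\frac{1}{2} \frac{g_s}{1-\frac{1}{2}g_s}\Phi^*_s\right)^2\right] \leq 2\varepsilon,$$ then $d(0,t) \leq \varepsilon$.
   Context: For $s<t$ put $P^{s,t}=P_{s+1}\cdots P_t$, and let $P^{s,s}$ be the identity. ''$\pi_t$ exists'' means that $\lim_{s\to-\infty}P^{s,t}(x,y)$ exists for all $x,y\in[n]$ and does not depend on $x$; then $\pi_t(y)$ denotes this limit (a probability distribution on $[n]$). For $A\subset[n]$, $\pi_t(A)=\sum_{x\in A}\pi_t(x)$. The assumptions imply $\pi_t(x)>0$ for all $t\ge0$, $x\in[n]$. For $t\ge1$ define: - $Q_t(A,B)=\sum_{x\in A}\sum_{y\in B}\pi_{t-1}(x)P_t(x,y)$ for $A,B\subset[n]$; - $g_t=\min_{z\in[n]}\frac{\pi_{t-1}(z)}{\pi_t(z)}\in(0,1]$; - $\Phi_t(S)=\frac{1}{2\pi_{t-1}(S)}\big(Q_t(S,S^c)+Q_t(S^c,S)\big)$ for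 nonempty $S\subset[n]$; - $\Phi_t^*=\inf\{\Phi_t(S): \emptyset\ne S\subset[n],\ \pi_{t-1}(S)\le 1/2\}$. Also $\pi_t^{\mathrm{min}}=\min_{z\in[n]}\pi_t(z)$ and $d(0,t)=\sup_{x\in[n]}\|P^{0,t}(x,\cdot)-\pi_t(\cdot)\|_{\mathrm{TV}}$ with $\|\mu-\nu\|_{\mathrm{TV}}=\frac12\sum_x|\mu(x)-\nu(x)|$. *)

(* Defs.v *)
From HB Require Import structures.
From mathcomp Require Import all_boot all_order all_algebra.
From mathcomp Require Import all_classical all_reals all_analysis.

Set Implicit Arguments.
Unset Strict Implicit.
Unset Printing Implicit Defensive.

Import Order.TTheory GRing.Theory Num.Theory.
Import numFieldNormedType.Exports.

Local Open Scope classical_set_scope.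
Local Open Scope ring_scope.

(* The state space [n], n >= 1, is 'I_n.+1, so that it is nonempty by typing. *)

Definition stochastic (R : realType) (n : nat) (A : 'M[R]_n.+1) : Prop :=
  (forall x y, 0 <= A x y) /\ (forall x, \sum_y A x y = 1).

(* P^{s,t} = P_{s+1} ... P_t, factors in increasing order of time.  Only
   meaningful for s <= t. *)
Definition transition (R : realType) (n : nat) (P : int -> 'M[R]_n.+1)
    (s t : int) : 'M[R]_n.+1 :=
  \prod_(0 <= k < `|t - s|%N) P (s + k.+1%:Z).

(* The limit s -> -oo is taken along s = t - m with m : nat, m -> oo. *)
Definition target_exists (R : realType) (n : nat) (P : int -> 'M[R]_n.+1)
    (t : int) : Prop :=
  exists mu : 'I_n.+1 -> R,
    forall x y, transition P (t - m%:Z) t x y @[m --> \oo] --> mu y.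

(* The row ord0 is an arbitrary choice: when target_exists P t holds, the limit
   does not depend on the row. *)
Definition target (R : realType) (n : nat) (P : int -> 'M[R]_n.+1)
    (t : int) (y : 'I_n.+1) : R :=
  limn (fun m : nat => transition P (t - m%:Z) t ord0 y).

Definition target_set (R : realType) (n : nat) (P : int -> 'M[R]_n.+1)
    (t : int) (A : {set 'I_n.+1}) : R :=
  \sum_(x in A) target P t x.

Definition edge_flow (R : realType) (n : nat) (P : int -> 'M[R]_n.+1)
    (t : int) (A B : {set 'I_n.+1}) : R :=
  \sum_(x in A) \sum_(y in B) target P (t - 1) x * P t x y.

(* The default value of the iterated minimum is itself one of the values. *)
Definition min_val (R : realType) (n : nat) (f : 'I_n.+1 -> R) : R :=
  \big[Num.min/f ord0]_z f z.

Definition min_ratio (R : realType) (n : nat) (P : int -> 'M[R]_n.+1)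
    (t : int) : R :=
  min_val (fun z => target P (t - 1) z / target P t z).

Definition target_min (R : realType) (n : nat) (P : int -> 'M[R]_n.+1)
    (t : int) : R :=
  min_val (target P t).

Definition conductance_set (R : realType) (n : nat) (P : int -> 'M[R]_n.+1)
    (t : int) (S : {set 'I_n.+1}) : R :=
  (2 * target_set P (t - 1) S)^-1 *
    (edge_flow P t S (~: S) + edge_flow P t (~: S) S).

(* With a single state no S is admissible and this is inf set0 = 0 rather than
   +oo; the chain is then at its target from the start.  For positive targets
   on at least two states an admissible singleton exists. *)
Definition conductance (R : realType) (n : nat) (P : int -> 'M[R]_n.+1)
    (t : int) : R :=
  inf [set conductance_set P t S | S in
         [set S : {set 'I_n.+1} | S != finset.set0 /\
                                  target_set P (t - 1) S <= 2^-1]].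

Definition tv_dist (R : realType) (n : nat) (mu nu : 'I_n.+1 -> R) : R :=
  2^-1 * \sum_x `|mu x - nu x|.

Definition mix_dist (R : realType) (n : nat) (P : int -> 'M[R]_n.+1)
    (s t : int) : R :=
  sup (range (fun x : 'I_n.+1 =>
    tv_dist (fun y => transition P s t x y) (target P t))).

(* Main.v *)
(* Evolving sets, in the style of Morris and Peres.  Write p = pi_(s-1) and
   q = pi_s.  For a set S of p-mass at most 1/2, let F(y) be the flow from S
   into y, so that the density F/q is at least g_s/2 on S and at most 1 - g_s/2
   off S by laziness.  Cut F/q at height 1/2 and write each half, doubled, as a
   mixture of indicator functions.  The two halves have mean masses p(S) + M
   and p(S) - M, where M = sum_y min(F(y), q(y) - F(y)) is bounded below by the
   symmetrized flow across the boundary of S, so concavity of the square root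
   shows that the mean of sqrt(q(S')) over the mixture is at most
   (1 - psi_s) sqrt(p(S)), psi_s being half the square in the s-th factor.
   Thus the signed measure p (1_S - p(S)), pushed forward by P_s, is a mixture of
   measures q (1_S' - q(S')), and by induction (replacing a set by its complement
   when its mass exceeds 1/2) its final L^1 norm is at most
   sqrt(p(S)) prod (1 - psi_s).  For S = {x} at time 0 this signed measure is
   pi_0(x) (delta_x - pi_0), which gives
   2 d(0,t) <= max_x pi_0(x)^(-1/2) prod_s (1 - psi_s). *)

Require Import Defs.
From HB Require Import structures.
From mathcomp Require Import all_boot all_order all_algebra.
From mathcomp Require Import all_classical all_reals all_analysis.
From mathcomp Require Import ring lra zify.

Set Implicit Arguments.
Unset Strict Implicit.
Unset Printing Implicit Defensive.

Import Order.TTheory GRing.Theory Num.Theory.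
Import numFieldNormedType.Exports.

Local Open Scope classical_set_scope.
Local Open Scope ring_scope.

(** * Product mixtures and scalar inequalities *)

(* The weights are those of the random set containing each point x
   independently with probability f x. *)
Lemma indicator_mixture (R : realFieldType) (T : finType) (f : T -> R) :
  (forall x, 0 <= f x <= 1) ->
  exists w : {set T} -> R,
    [/\ forall S, 0 <= w S, \sum_S w S = 1
      & forall x, \sum_S w S * (x \in S)%:R = f x].
Proof.
move=> f01.
pose w (S : {set T}) := \prod_x (if x \in S then f x else 1 - f x).
exists w; split=> [S||x].
- by apply: prodr_ge0 => x _; have := f01 x; case: ifP => _; lra.
- have <- : \prod_x (f x + (1 - f x)) = 1 by apply: big1 => x _; rewrite subrKC.
  by rewrite bigA_distr.
(* Replacing the factor 1 - f x by 0 deletes the sets that omit x from the expanded product. *)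
- have -> : f x = \prod_y (f y + (if y == x then 0 else 1 - f y)).
    rewrite (bigD1 x) //= eqxx addr0 big1 ?mulr1 // => y /negbTE ->.
    by rewrite subrKC.
  rewrite bigA_distr; apply: eq_bigr => S _.
  have [xS|xS] := boolP (x \in S); last first.
    by rewrite mulr0 (bigD1 x) //= (negbTE xS) eqxx mul0r.
  rewrite mulr1; apply: eq_bigr => y _.
  by case: ifP => // yS; case: eqP yS => // ->; rewrite xS.
Qed.

(** Jensen for the square root: the variance of [Num.sqrt (a i)] under the weights is
    nonnegative. *)
Lemma sum_sqrt_le (R : rcfType) (I : finType) (w a : I -> R) :
  (forall i, 0 <= w i) -> \sum_i w i = 1 -> (forall i, 0 <= a i) ->
  \sum_i w i * Num.sqrt (a i) <= Num.sqrt (\sum_i w i * a i).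
Proof.
move=> w0 w1 a0.
have : 0 <= \sum_i w i * Num.sqrt (a i).
  by apply: sumr_ge0 => i _; rewrite mulr_ge0 ?sqrtr_ge0.
move mE: (\sum_i w i * Num.sqrt (a i)) => m m0.
rewrite -[m](ger0_norm m0) -sqrtr_sqr; apply: ler_wsqrtr.
have : 0 <= \sum_i w i * (Num.sqrt (a i) - m) ^+ 2.
  by apply: sumr_ge0 => i _; rewrite mulr_ge0 ?sqr_ge0.
have -> : \sum_i w i * (Num.sqrt (a i) - m) ^+ 2 =
    \sum_i w i * a i - 2 * m * (\sum_i w i * Num.sqrt (a i)) +
    m ^+ 2 * \sum_i w i.
  rewrite !mulr_sumr -sumrB -big_split /=; apply: eq_bigr => i _.
  by have := sqr_sqrtr (a0 i); set r := Num.sqrt _ => <-; ring.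
by rewrite w1 mE; lra.
Qed.

(* Squaring: with X, Y, Z the three roots, ((X + Y)/2)^2 = Z^2 - ((X - Y)/2)^2
   and X - Y >= 2 b Z, because (X - Y)(X + Y) >= 4 b Z^2 and X + Y <= 2 Z. *)
Lemma split_sqrt_le (R : rcfType) (u v a b : R) :
  0 <= u -> 0 <= v -> 0 < a -> 0 <= b -> u + v = 2 * a ->
  4 * (a * b) <= u - v ->
  2^-1 * (Num.sqrt u + Num.sqrt v) <= (1 - 2^-1 * b ^+ 2) * Num.sqrt a.
Proof.
move=> u0 v0 a0 b0 uv uvb.
set X := Num.sqrt u; set Y := Num.sqrt v; set Z := Num.sqrt a.
have X0 : 0 <= X by exact: sqrtr_ge0.
have Y0 : 0 <= Y by exact: sqrtr_ge0.
have Z0 : 0 < Z by rewrite sqrtr_gt0.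
have uX : X * X = u by rewrite -expr2 sqr_sqrtr.
have vY : Y * Y = v by rewrite -expr2 sqr_sqrtr.
have aZ : Z * Z = a by rewrite -expr2 sqr_sqrtr // ltW.
have sq : (X + Y) ^+ 2 + (X - Y) ^+ 2 = (2 * Z) ^+ 2.
  by rewrite -uX -vY -aZ in uv; rewrite !expr2; lra.
have XYZ : X + Y <= 2 * Z.
  rewrite -(@ler_pXn2r _ 2) ?nnegrE ?addr_ge0 ?mulr_ge0 ?ler0n ?(ltW Z0) //.
  by rewrite -sq lerDl sqr_ge0.
have XYb : 2 * b * Z <= X - Y.
  have : 0 <= X - Y.
    by rewrite subr_ge0 ler_sqrt // -subr_ge0; have := mulr_ge0 (ltW a0) b0; lra.
  move=> d0; rewrite -(ler_pM2r (_ : 0 < 2 * Z)); last by rewrite mulr_gt0.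
  apply: (@le_trans _ _ ((X - Y) * (X + Y))); last exact: ler_wpM2l.
  have -> : (X - Y) * (X + Y) = u - v by rewrite -uX -vY; ring.
  by rewrite -mulrA mulrACA -aZ in uvb *; lra.
have sqb : (2 * b * Z) ^+ 2 <= (X - Y) ^+ 2.
  by rewrite ler_pXn2r ?nnegrE ?mulr_ge0 ?ler0n ?(ltW Z0) // (le_trans _ XYb)
     ?mulr_ge0 ?ler0n ?(ltW Z0).
(* Makes the right-hand side nonnegative, so that the inequality can be squared. *)
have b1 : b ^+ 2 <= 1.
  have : (2 * Z) ^+ 2 * b ^+ 2 <= (2 * Z) ^+ 2 * 1.
    rewrite mulr1 -[leRHS]sq; apply: (le_trans _ (_ : (X - Y) ^+ 2 <= _)).
      by move: sqb; rewrite !exprMn; lra.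
    by rewrite lerDr sqr_ge0.
  by rewrite ler_pM2l // exprn_gt0 // mulr_gt0.
have L0 : 0 <= 2^-1 * (X + Y) by lra.
have R0 : 0 <= (1 - 2^-1 * b ^+ 2) * Z by rewrite mulr_ge0 ?(ltW Z0) //; lra.
rewrite -(@ler_pXn2r _ 2) //.
have Zb : 0 <= Z ^+ 2 * (b ^+ 2) ^+ 2 by rewrite mulr_ge0 ?sqr_ge0.
have -> : (2^-1 * (X + Y)) ^+ 2 = 4^-1 * ((2 * Z) ^+ 2 - (X - Y) ^+ 2).
  by rewrite -sq; field.
have -> : ((1 - 2^-1 * b ^+ 2) * Z) ^+ 2 =
    Z ^+ 2 - b ^+ 2 * Z ^+ 2 + 4^-1 * (Z ^+ 2 * (b ^+ 2) ^+ 2) by field.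
by move: sqb; rewrite !exprMn; lra.
Qed.

(** F and G split the mass q(y). Laziness keeps a fraction gamma of it in G, so (1 - gamma) G >=
    gamma F; and gamma <= 1/2 makes the ratio at most 1. *)
Lemma lazy_min_ge (R : realFieldType) (gamma F G : R) :
  0 < gamma -> gamma <= 2^-1 -> 0 <= F -> gamma * (F + G) <= G ->
  gamma / (1 - gamma) * F <= Num.min F G.
Proof.
move=> g0 g2 F0 FG; have g1 : 0 < 1 - gamma by lra.
rewrite le_min mulrAC !ler_pdivrMr //; apply/andP; split; last by lra.
rewrite mulrC ler_wpM2l //; lra.
Qed.

(** * One step of the evolving sets *)

Definition mass (R : realType) (n : nat) (p : 'I_n.+1 -> R)
    (S : {set 'I_n.+1}) : R := \sum_(x in S) p x.

Definition distribution (R : realType) (n : nat) (p : 'I_n.+1 -> R) : Prop :=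
  (forall x, 0 < p x) /\ \sum_x p x = 1.

Definition inflow (R : realType) (n : nat) (p : 'I_n.+1 -> R)
    (A : 'M[R]_n.+1) (S : {set 'I_n.+1}) (y : 'I_n.+1) : R :=
  \sum_(x in S) p x * A x y.

(** The analogue of [conductance_set] for an arbitrary p, so that the one-step estimate involves no
    limits. *)
Definition conductance_of (R : realType) (n : nat) (p : 'I_n.+1 -> R)
    (A : 'M[R]_n.+1) (S : {set 'I_n.+1}) : R :=
  (2 * mass p S)^-1 *
    (\sum_(x in S) \sum_(y in ~: S) p x * A x y +
     \sum_(x in ~: S) \sum_(y in S) p x * A x y).

(* The signed measure p (1_S - p(S)). *)
Definition centered (R : realType) (n : nat) (p : 'I_n.+1 -> R)
    (S : {set 'I_n.+1}) : 'rV[R]_n.+1 :=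
  \row_x (p x * ((x \in S)%:R - mass p S)).

Lemma sum_setC (R : realType) (n : nat) (f : 'I_n.+1 -> R)
    (S : {set 'I_n.+1}) :
  \sum_x f x = \sum_(x in S) f x + \sum_(x in ~: S) f x.
Proof.
rewrite (bigID (fun x => x \in S)) /=; congr (_ + _).
by apply: eq_bigl => x; rewrite inE.
Qed.

Lemma mass_setC (R : realType) (n : nat) (p : 'I_n.+1 -> R)
    (S : {set 'I_n.+1}) : distribution p -> mass p (~: S) = 1 - mass p S.
Proof. by case=> _ p1; rewrite -p1 (sum_setC p S) addrC addKr. Qed.

Lemma mass_ge0 (R : realType) (n : nat) (p : 'I_n.+1 -> R)
    (S : {set 'I_n.+1}) : distribution p -> 0 <= mass p S.
Proof. by case=> p0 _; apply: sumr_ge0 => x _; exact: ltW. Qed.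

Lemma mass_gt0 (R : realType) (n : nat) (p : 'I_n.+1 -> R)
    (S : {set 'I_n.+1}) : distribution p -> S != finset.set0 -> 0 < mass p S.
Proof.
case=> p0 _ /set0Pn[x xS]; rewrite /mass (bigD1 x) //=.
by rewrite ltr_pwDl // sumr_ge0 // => y _; exact: ltW.
Qed.

Lemma inflow_ge (R : realType) (n : nat) (p : 'I_n.+1 -> R) (A : 'M[R]_n.+1)
    (S : {set 'I_n.+1}) (y : 'I_n.+1) :
  distribution p -> stochastic A -> y \in S -> p y * A y y <= inflow p A S y.
Proof.
case=> p0 _ [A0 _] yS; rewrite /inflow (bigD1 y) //= lerDl.
by apply: sumr_ge0 => x _; rewrite mulr_ge0 ?(ltW (p0 x)).
Qed.

Lemma inflow_ge0 (R : realType) (n : nat) (p : 'I_n.+1 -> R)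
    (A : 'M[R]_n.+1) (S : {set 'I_n.+1}) (y : 'I_n.+1) :
  distribution p -> stochastic A -> 0 <= inflow p A S y.
Proof.
case=> p0 _ [A0 _].
by apply: sumr_ge0 => x _; rewrite mulr_ge0 ?(ltW (p0 x)).
Qed.

Lemma sum_inflow (R : realType) (n : nat) (p : 'I_n.+1 -> R)
    (A : 'M[R]_n.+1) (S : {set 'I_n.+1}) :
  stochastic A -> \sum_y inflow p A S y = mass p S.
Proof.
case=> _ A1; rewrite exchange_big /=; apply: eq_bigr => x _.
by rewrite -mulr_sumr A1 mulr1.
Qed.

Lemma mass_mixture (R : realType) (n : nat) (q f : 'I_n.+1 -> R)
    (w : {set 'I_n.+1} -> R) :
  (forall x, \sum_S w S * (x \in S)%:R = f x) ->
  \sum_S w S * mass q S = \sum_x q x * f x.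
Proof.
move=> wf; under [RHS]eq_bigr => x _ do rewrite -wf mulr_sumr.
rewrite exchange_big /=; apply: eq_bigr => S _.
rewrite mulr_sumr big_mkcond /=; apply: eq_bigr => x _.
by case: (x \in S); rewrite ?mulr1 ?mulr0 // mulrC.
Qed.

Lemma evolving_step (R : realType) (n : nat) (p q : 'I_n.+1 -> R)
    (A : 'M[R]_n.+1) (gamma : R) (S : {set 'I_n.+1}) :
  distribution p -> distribution q -> stochastic A ->
  (forall y, q y = \sum_x p x * A x y) ->
  0 < gamma -> gamma <= 2^-1 -> (forall y, gamma * q y <= p y * A y y) ->
  S != finset.set0 ->
  exists w : {set 'I_n.+1} -> R,
    [/\ forall S', 0 <= w S',
        centered p S *m A = \sum_S' w S' *: centered q S'
      & \sum_S' w S' * Num.sqrt (mass q S') <=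
        (1 - 2^-1 * (gamma / (1 - gamma) * conductance_of p A S) ^+ 2)
        * Num.sqrt (mass p S)].
Proof.
move=> dp dq stA qE g0 g2 lazy SN.
have [q0 q1] := dq.
pose F := inflow p A S; pose G := inflow p A (~: S).
have qFG y : q y = F y + G y by rewrite qE (sum_setC _ S).
have F0 y : 0 <= F y by exact: inflow_ge0.
have G0 y : 0 <= G y by exact: inflow_ge0.
pose m y := Num.min (F y) (G y).
have m0 y : 0 <= m y by rewrite le_min F0 G0.
have mF y : m y <= F y by rewrite ge_min lexx.
have mG y : m y <= G y by rewrite ge_min lexx orbT.
(* The parts of the density F / q below and above 1/2, doubled. *)
pose f1 y := (F y + m y) / q y; pose f2 y := (F y - m y) / q y.
have f1_01 y : 0 <= f1 y <= 1.
  rewrite /f1 ler_pdivrMr // divr_ge0 ?addr_ge0 ?(ltW (q0 y)) //=.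
  by rewrite mul1r qFG lerD2l.
have f2_01 y : 0 <= f2 y <= 1.
  rewrite /f2 ler_pdivrMr // divr_ge0 ?subr_ge0 ?(ltW (q0 y)) //=.
  by rewrite mul1r qFG; have := m0 y; have := G0 y; lra.
have [w1 [w1_0 w1_1 w1f]] := indicator_mixture f1_01.
have [w2 [w2_0 w2_1 w2f]] := indicator_mixture f2_01.
have mass1 : \sum_T w1 T * mass q T = mass p S + \sum_y m y.
  rewrite (mass_mixture _ w1f) -(sum_inflow p S stA) -big_split /=.
  by apply: eq_bigr => y _; rewrite mulrC divfK // gt_eqF.
have mass2 : \sum_T w2 T * mass q T = mass p S - \sum_y m y.
  rewrite (mass_mixture _ w2f) -(sum_inflow p S stA) -sumrB /=.
  by apply: eq_bigr => y _; rewrite mulrC divfK // gt_eqF.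
exists (fun T => 2^-1 * (w1 T + w2 T)); split.
- by move=> T; rewrite mulr_ge0 ?addr_ge0 ?invr_ge0.
(* The average of [f1] and [f2] is F/q, and the two mean masses average to p(S): both sides are F(y)
   - p(S) q(y). *)
- apply/rowP => y; rewrite !mxE summxE.
  have -> : \sum_T ((2^-1 * (w1 T + w2 T)) *: centered q T) ord0 y =
      q y * (2^-1 * (\sum_T w1 T * (y \in T)%:R + \sum_T w2 T * (y \in T)%:R)
        - 2^-1 * (\sum_T w1 T * mass q T + \sum_T w2 T * mass q T)).
    rewrite -!big_split /= !mulr_sumr -sumrB mulr_sumr.
    by apply: eq_bigr => T _; rewrite !mxE; ring.
  rewrite w1f w2f mass1 mass2 /f1 /f2.
  have -> : \sum_x centered p S ord0 x * A x y = F y - mass p S * q y.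
    rewrite qE mulr_sumr /F /inflow.
    rewrite [X in _ = X - _]big_mkcond /= -sumrB.
    apply: eq_bigr => x _; rewrite mxE.
    by case: (x \in S) => /=; ring.
  by field; rewrite gt_eqF.
- have -> : \sum_T 2^-1 * (w1 T + w2 T) * Num.sqrt (mass q T) =
      2^-1 * (\sum_T w1 T * Num.sqrt (mass q T) +
              \sum_T w2 T * Num.sqrt (mass q T)).
    by rewrite -big_split mulr_sumr; apply: eq_bigr => T _ /=; ring.
  have q_ge0 T : 0 <= mass q T by exact: mass_ge0.
  (* Jensen is applied to each half separately, which keeps the gap 2M between their mean masses. *)
  apply: (@le_trans _ _ (2^-1 * (Num.sqrt (mass p S + \sum_y m y) +
                                 Num.sqrt (mass p S - \sum_y m y)))).
    by rewrite ler_wpM2l ?invr_ge0 // -mass1 -mass2 lerD ?sum_sqrt_le.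
  have a0 : 0 < mass p S by exact: mass_gt0.
  have M0 : 0 <= \sum_y m y by exact: sumr_ge0.
  have g1 : 0 < 1 - gamma by lra.
  apply: split_sqrt_le => //.
  + by rewrite addr_ge0 // ltW.
  + by rewrite -(sum_inflow p S stA) -sumrB sumr_ge0 // => y _; rewrite subr_ge0.
  + have [p0 _] := dp; have [A0 _] := stA.
    rewrite mulr_ge0 ?divr_ge0 ?(ltW g0) ?(ltW g1) // mulr_ge0 //.
      by rewrite invr_ge0 mulr_ge0 // ltW.
    by rewrite addr_ge0 //; apply: sumr_ge0 => x _; apply: sumr_ge0 => y _;
      rewrite mulr_ge0 ?(ltW (p0 x)).
  + by ring.
  (* G summed over S and F summed over its complement are the two boundary flows. *)
  + have -> : 4 * (mass p S * (gamma / (1 - gamma) * conductance_of p A S)) =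
        2 * (gamma / (1 - gamma) * (\sum_(y in S) G y + \sum_(y in ~: S) F y)).
      rewrite /conductance_of [X in _ * (X + _)]exchange_big /=.
      rewrite [X in _ * (_ + X)]exchange_big /=.
      by field; rewrite !gt_eqF.
    have -> : mass p S + \sum_y m y - (mass p S - \sum_y m y) = 2 * \sum_y m y.
      by ring.
    rewrite ler_pM2l // (sum_setC m S) mulrDr !mulr_sumr.
    (* The mass held at y belongs to F when y is in S and to G otherwise, so F and G swap roles. *)
    apply: lerD; apply: ler_sum => y; rewrite ?inE => yS.
      rewrite /m minC; apply: lazy_min_ge => //.
      by rewrite addrC -qFG (le_trans (lazy y)) // inflow_ge.
    apply: lazy_min_ge => //.
    by rewrite -qFG (le_trans (lazy y)) // inflow_ge // inE.
Qed.

(** * Contraction along the evolving sets *)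

Definition norm1 (R : realType) (n : nat) (v : 'rV[R]_n.+1) : R :=
  \sum_y `|v ord0 y|.

Lemma norm1N (R : realType) (n : nat) (v : 'rV[R]_n.+1) :
  norm1 (- v) = norm1 v.
Proof. by apply: eq_bigr => y _; rewrite mxE normrN. Qed.

Lemma norm1Z (R : realType) (n : nat) (a : R) (v : 'rV[R]_n.+1) :
  norm1 (a *: v) = `|a| * norm1 v.
Proof. by rewrite /norm1 mulr_sumr; apply: eq_bigr => y _; rewrite mxE normrM. Qed.

Lemma norm1_sum_le (R : realType) (n : nat) (I : finType)
    (v : I -> 'rV[R]_n.+1) : norm1 (\sum_i v i) <= \sum_i norm1 (v i).
Proof.
rewrite /norm1 exchange_big; apply: ler_sum => y _.
by rewrite summxE ler_norm_sum.
Qed.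

Lemma norm1_centered (R : realType) (n : nat) (p : 'I_n.+1 -> R)
    (S : {set 'I_n.+1}) :
  distribution p -> norm1 (centered p S) = 2 * mass p S * (1 - mass p S).
Proof.
move=> dp; have [p0 _] := dp; have a0 := mass_ge0 S dp.
have a1 : 0 <= 1 - mass p S by rewrite -mass_setC // mass_ge0.
have -> : norm1 (centered p S) =
    (\sum_(x in S) p x) * (1 - mass p S) + (\sum_(x in ~: S) p x) * mass p S.
  rewrite /norm1 (sum_setC _ S) !mulr_suml.
  congr (_ + _); apply: eq_bigr => x; rewrite ?inE mxE normrM gtr0_norm //.
    by move=> ->; rewrite ger0_norm.
  by move=> /negbTE ->; rewrite sub0r normrN ger0_norm.
by rewrite -/(mass p S) -/(mass p (~: S)) mass_setC //; ring.
Qed.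

(** Passing to the complement preserves the L^1 norm; this reduces to sets of mass at most 1/2. *)
Lemma centered_setC (R : realType) (n : nat) (p : 'I_n.+1 -> R)
    (S : {set 'I_n.+1}) :
  distribution p -> centered p (~: S) = - centered p S.
Proof.
move=> dp; apply/rowP => x; rewrite !mxE mass_setC // inE.
by case: (x \in S) => /=; ring.
Qed.

(** The base case of the contraction. By symmetry a may be replaced by b = min(a, 1 - a), and (2b(1
    - b))^2 <= b(1 - b) <= b because 4b(1 - b) <= 1. *)
Lemma sqrt_min_ge (R : rcfType) (a : R) :
  0 <= a <= 1 -> 2 * a * (1 - a) <= Num.sqrt (Num.min a (1 - a)).
Proof.
move=> a01; set b := Num.min a (1 - a).
have [b0 b2 ->] : [/\ 0 <= b, b <= 2^-1 & 2 * a * (1 - a) = 2 * b * (1 - b)].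
  by rewrite /b; case: (leP a (1 - a)) => ha; split; try lra; ring.
rewrite -[leLHS]ger0_norm; last by rewrite mulr_ge0 ?mulr_ge0 //; lra.
rewrite -sqrtr_sqr ler_wsqrtr //.
have h1 : 4 * b * (1 - b) <= 1 by have := sqr_ge0 (1 - 2 * b); rewrite expr2; lra.
have -> : (2 * b * (1 - b)) ^+ 2 = b * (1 - b) * (4 * b * (1 - b)) by ring.
apply: (@le_trans _ _ (b * (1 - b) * 1)).
  by apply: ler_wpM2l h1; rewrite mulr_ge0 //; lra.
by rewrite mulr1 ler_piMr //; lra.
Qed.

(** Induction on the number of remaining steps, for all starting times and sets at once. The minimum
    makes the bound invariant under complement, while [step] covers only sets of mass at most
    1/2. *)
Lemma evolving_sets_bound (R : realType) (n : nat) (p : nat -> 'I_n.+1 -> R)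
    (A : nat -> 'M[R]_n.+1) (c : nat -> R) :
  (forall k, distribution (p k)) -> (forall k, 0 <= c k) ->
  (forall k (S : {set 'I_n.+1}), S != finset.set0 -> mass (p k) S <= 2^-1 ->
     exists w : {set 'I_n.+1} -> R,
       [/\ forall S', 0 <= w S',
           centered (p k) S *m A k = \sum_S' w S' *: centered (p k.+1) S'
         & \sum_S' w S' * Num.sqrt (mass (p k.+1) S') <=
           c k * Num.sqrt (mass (p k) S)]) ->
  forall d k (S : {set 'I_n.+1}),
    norm1 (centered (p k) S *m \prod_(k <= j < k + d) A j) <=
    \prod_(k <= j < k + d) c j *
      Num.sqrt (Num.min (mass (p k) S) (1 - mass (p k) S)).
Proof.
move=> dp c0 step; elim=> [|d IH] k S.
  rewrite addn0 !big_geq // mulmx1 mul1r norm1_centered //.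
  apply: sqrt_min_ge; rewrite mass_ge0 //=.
  by rewrite -subr_ge0 -mass_setC // mass_ge0.
wlog S2 : S / mass (p k) S <= 2^-1.
  move=> wlg; have [/wlg //|S2] := leP (mass (p k) S) 2^-1.
  rewrite -norm1N -mulNmx -centered_setC // minC.
  have -> : Num.min (1 - mass (p k) S) (mass (p k) S) =
      Num.min (mass (p k) (~: S)) (1 - mass (p k) (~: S)).
    by rewrite mass_setC // subKr.
  by apply: wlg; rewrite mass_setC //; lra.
have C0 : 0 <= \prod_(k.+1 <= j < k.+1 + d) c j.
  by apply: prodr_ge0 => j _.
(* The mixture may charge the empty set, whose centered measure vanishes. *)
have [->|SN] := eqVneq S finset.set0.
  rewrite [centered _ _](_ : _ = 0).
    rewrite mul0mx /norm1 big1 => [|y _]; last by rewrite mxE normr0.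
    by rewrite mulr_ge0 ?sqrtr_ge0 // prodr_ge0.
  by apply/rowP => x; rewrite !mxE /mass big_set0 inE /=; ring.
have [w [w0 wE wle]] := step k S SN S2.
rewrite (minEle (mass _ _)) ifT; last by lra.
rewrite -addSnnS !(big_ltn (_ : (k < _)%N)) ?leq_addr //.
rewrite mulmxA wE mulmx_suml (le_trans (norm1_sum_le _)) //.
apply: (@le_trans _ _ (\prod_(k.+1 <= j < k.+1 + d) c j *
   \sum_S' w S' * Num.sqrt (mass (p k.+1) S'))).
  rewrite mulr_sumr; apply: ler_sum => T _.
  rewrite -scalemxAl norm1Z ger0_norm // mulrCA ler_wpM2l //.
  apply: (le_trans (IH _ _)); rewrite ler_wpM2l // ler_wsqrtr //.
  by rewrite ge_min lexx.
by rewrite [c k * _]mulrC -mulrA ler_wpM2l.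
Qed.

(** * Target distributions *)

Lemma transitionE (R : realType) (n : nat) (P : int -> 'M[R]_n.+1) (t : int)
    (m : nat) :
  transition P (t - m%:Z) t = \prod_(0 <= k < m) P (t - m%:Z + k.+1%:Z).
Proof. by rewrite /transition (_ : `|_|%N = m); last by lia. Qed.

Lemma transitionS (R : realType) (n : nat) (P : int -> 'M[R]_n.+1) (t : int)
    (m : nat) :
  transition P (t - m.+1%:Z) t = transition P (t - 1 - m%:Z) (t - 1) *m P t.
Proof.
rewrite !transitionE big_nat_recr //= -mulmxE; congr (_ *m _).
  by apply: eq_bigr => k _; congr P; lia.
by congr P; lia.
Qed.

Lemma stochasticM (R : realType) (n : nat) (A B : 'M[R]_n.+1) :
  stochastic A -> stochastic B -> stochastic (A *m B).
Proof.
move=> [A0 A1] [B0 B1]; split=> [x y|x].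
  by rewrite mxE sumr_ge0 // => z _; rewrite mulr_ge0.
under eq_bigr => y _ do rewrite mxE.
rewrite exchange_big /= -[RHS](A1 x); apply: eq_bigr => z _.
by rewrite -mulr_sumr B1 mulr1.
Qed.

Lemma stochastic_transition (R : realType) (n : nat) (P : int -> 'M[R]_n.+1)
    (s t : int) :
  (forall s, stochastic (P s)) -> stochastic (transition P s t).
Proof.
move=> stP; apply: big_ind => [|A B|k _] //; last exact: stochasticM.
split=> [x y|x]; first by rewrite mxE ler0n.
rewrite (bigD1 x) //= !mxE eqxx big1 ?addr0 // => y /negbTE yx.
by rewrite mxE eq_sym yx.
Qed.

(** [target] reads only row [ord0]; independence of the row extends the limit to every x. *)
Lemma cvg_target (R : realType) (n : nat) (P : int -> 'M[R]_n.+1) (t : int)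
    (x y : 'I_n.+1) :
  target_exists P t ->
  transition P (t - m%:Z) t x y @[m --> \oo] --> target P t y.
Proof.
case=> mu mu_lim; rewrite /target (_ : limn _ = mu y) //.
by apply: cvg_lim => //; exact: mu_lim.
Qed.

Lemma target_ge0 (R : realType) (n : nat) (P : int -> 'M[R]_n.+1) (t : int)
    (y : 'I_n.+1) :
  (forall s, stochastic (P s)) -> target_exists P t -> 0 <= target P t y.
Proof.
move=> stP tP; have lim_y := @cvg_target R n P t ord0 y tP.
rewrite -(cvg_lim _ lim_y) //; apply: limr_ge.
  by apply/cvg_ex; exists (target P t y).
by near=> m; have [] := stochastic_transition (t - m%:Z) t stP.
Unshelve. all: by end_near.
Qed.

Lemma sum_target (R : realType) (n : nat) (P : int -> 'M[R]_n.+1) (t : int) :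
  (forall s, stochastic (P s)) -> target_exists P t ->
  \sum_y target P t y = 1.
Proof.
move=> stP tP; symmetry; apply: (@cvg_unique _ _ (fmap (fun=> 1 : R) \oo)) => //.
  exact: cvg_cst.
have -> : (fun=> 1 : R) =
    (fun m : nat => \sum_y transition P (t - m%:Z) t ord0 y).
  by apply/funext => m; have [_ ->] := stochastic_transition (t - m%:Z) t stP.
by apply: cvg_big => [|y _]; [exact: add_continuous|exact: cvg_target].
Qed.

(** Let s tend to -oo in P^{s,t} = P^{s,t-1} P_t. *)
Lemma target_step (R : realType) (n : nat) (P : int -> 'M[R]_n.+1) (t : int)
    (y : 'I_n.+1) :
  (forall s, target_exists P s) ->
  target P t y = \sum_x target P (t - 1) x * P t x y.
Proof.
move=> tP.
have lim_y : (fun m : nat => transition P (t - m.+1%:Z) t ord0 y) @ \oo -->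
    target P t y.
  by rewrite (cvg_shiftS (fun m => transition P (t - m%:Z) t ord0 y));
    exact: cvg_target.
apply: (cvg_unique _ lim_y) => //=.
under eq_fun => m do rewrite transitionS mxE.
apply: cvg_big => [|x _]; first exact: add_continuous.
by apply: cvgM; [exact: cvg_target|exact: cvg_cst].
Qed.

(** By laziness a state keeps at least half of its mass at each step. *)
Lemma target_gt0 (R : realType) (n : nat) (P : int -> 'M[R]_n.+1) (s : int)
    (d : nat) (x : 'I_n.+1) :
  (forall s, stochastic (P s)) -> (forall s, target_exists P s) ->
  (forall s x, 2^-1 <= P s x x) ->
  0 < target P s x -> 0 < target P (s + d%:Z) x.
Proof.
move=> stP tP lazy; elim: d => [|d IH] h; first by rewrite addr0.
rewrite target_step // (_ : _ - 1 = s + d%:Z); last by lia.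
have Pxx : 0 < P (s + d.+1%:Z) x x by rewrite (lt_le_trans _ (lazy _ _)) // invr_gt0.
rewrite (bigD1 x) //= ltr_pwDl ?mulr_gt0 ?IH // sumr_ge0 // => y _.
by rewrite mulr_ge0 ?target_ge0 //; have [] := stP (s + d.+1%:Z).
Qed.

(** * Minima and conductances of the targets *)

Lemma min_val_le (R : realType) (n : nat) (f : 'I_n.+1 -> R) (x : 'I_n.+1) :
  min_val f <= f x.
Proof. exact: bigmin_le. Qed.

Lemma min_val_gt0 (R : realType) (n : nat) (f : 'I_n.+1 -> R) :
  (forall x, 0 < f x) -> 0 < min_val f.
Proof. by move=> f0; apply: lt_bigmin. Qed.

Lemma conductance_set_ge0 (R : realType) (n : nat) (P : int -> 'M[R]_n.+1)
    (t : int) (S : {set 'I_n.+1}) :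
  stochastic (P t) -> (forall x, 0 <= target P (t - 1) x) ->
  0 <= conductance_set P t S.
Proof.
move=> [P0 _] p0; rewrite mulr_ge0 //.
  by rewrite invr_ge0 mulr_ge0 // sumr_ge0.
by rewrite addr_ge0 //; apply: sumr_ge0 => x _; apply: sumr_ge0 => y _;
  rewrite mulr_ge0.
Qed.

Lemma conductance_ge0 (R : realType) (n : nat) (P : int -> 'M[R]_n.+1)
    (t : int) :
  stochastic (P t) -> (forall x, 0 <= target P (t - 1) x) ->
  0 <= conductance P t.
Proof.
move=> P0 p0; rewrite /conductance; set E := [set _ | _ in _].
(* Without admissible sets the infimum takes its default value 0. *)
have [neE|emptyE] := pselect (E !=set0); last by rewrite inf_out // => -[].
by apply: lb_le_inf => // _ [S _ <-]; exact: conductance_set_ge0.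
Qed.

Lemma conductance_le (R : realType) (n : nat) (P : int -> 'M[R]_n.+1)
    (t : int) (S : {set 'I_n.+1}) :
  stochastic (P t) -> (forall x, 0 <= target P (t - 1) x) ->
  S != finset.set0 -> target_set P (t - 1) S <= 2^-1 ->
  conductance P t <= conductance_set P t S.
Proof.
move=> P0 p0 SN S2; apply: ge_inf; last by exists S.
by exists 0 => _ [T _ <-]; exact: conductance_set_ge0.
Qed.

(** * From the evolving sets to the mixing distance *)

Theorem theorem3p2 (R : realType) (n : nat) (P : int -> 'M[R]_n.+1)
    (P_stochastic : forall s : int, stochastic (P s))
    (P_target : forall t : int, target_exists P t)
    (P_lazy : forall (s : int) (x : 'I_n.+1), 2^-1 <= P s x x)
    (P_charged : forall x : 'I_n.+1, exists2 s : int, s < 0 & 0 < target P s x)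
    (eps : R) (eps_gt0 : 0 < eps) (eps_lt1 : eps < 1)
    (t : nat) (t_gt0 : (0 < t)%N)
    (small : (Num.sqrt (target_min P t%:Z * target_min P 0))^-1 *
       \prod_(1 <= s < t.+1)
          (1 - 2^-1 * (2^-1 * (min_ratio P s%:Z / (1 - 2^-1 * min_ratio P s%:Z))
                         * conductance P s%:Z) ^+ 2)
       <= 2 * eps) :
  mix_dist P 0 t%:Z <= eps.
Proof.
pose p (k : nat) := target P k%:Z.
pose A (k : nat) := P k.+1%:Z.
pose g (k : nat) := min_ratio P k.+1%:Z.
(* Index k stands for the step from time k to k + 1, so [c k] is the factor s = k + 1. *)
pose c (k : nat) := 1 - 2^-1 * (2^-1 * (g k / (1 - 2^-1 * g k))
                                * conductance P k.+1%:Z) ^+ 2.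
have predS k : k.+1%:Z - 1 = k%:Z by lia.
have p_gt0 k x : 0 < p k x.
  have [s s0 sx] := P_charged x.
  rewrite /p (_ : k%:Z = s + `|k%:Z - s|%N%:Z); last by lia.
  exact: target_gt0.
have dp k : distribution (p k) by split=> //; exact: sum_target.
have p_ge0 k x : 0 <= target P (k.+1%:Z - 1) x by rewrite predS ltW ?p_gt0.
have pS k y : p k.+1 y = \sum_x p k x * A k x y.
  by rewrite /p target_step // predS.
have g_gt0 k : 0 < g k.
  by apply: min_val_gt0 => x; rewrite predS divr_gt0 // p_gt0.
have g_le k y : g k * p k.+1 y <= p k y.
  rewrite -ler_pdivlMr // /g /min_ratio predS.
  exact: (min_val_le (fun z => target P k%:Z z / target P k.+1%:Z z)).
(* Sum [g_le] over y: both targets have total mass 1. *)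
have g_le1 k : g k <= 1.
  have [_ p1] := dp k; have [_ p1'] := dp k.+1.
  by rewrite -p1 -[g k]mulr1 -p1' mulr_sumr ler_sum.
have phi_ge0 k : 0 <= conductance P k.+1%:Z by exact: conductance_ge0.
have step k (S : {set 'I_n.+1}) : S != finset.set0 -> mass (p k) S <= 2^-1 ->
    exists w : {set 'I_n.+1} -> R,
      [/\ forall S', 0 <= w S',
          centered (p k) S *m A k = \sum_S' w S' *: centered (p k.+1) S'
        & \sum_S' w S' * Num.sqrt (mass (p k.+1) S') <=
          c k * Num.sqrt (mass (p k) S)].
  move=> SN S2; have gk0 := g_gt0 k; have gk1 := g_le1 k.
  have [||y|w [w0 wE wle]] := evolving_step (gamma := 2^-1 * g k)
      (dp k) (dp k.+1) (P_stochastic k.+1%:Z) (pS k) _ _ _ SN.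
  - by rewrite mulr_gt0 // invr_gt0.
  - by lra.
  (* The product of [g_le] and laziness, whence gamma = g/2. *)
  - rewrite -mulrA mulrC; apply: ler_pM => //.
    by rewrite mulr_ge0 // ltW // p_gt0.
  exists w; split=> //; apply: (le_trans wle).
  rewrite ler_wpM2r ?sqrtr_ge0 // lerD2l lerN2 ler_wpM2l ?invr_ge0 //.
  have le_phi : conductance P k.+1%:Z <= conductance_of (p k) (A k) S.
    have := conductance_le (P_stochastic k.+1%:Z) (p_ge0 k) SN.
    by rewrite /target_set /conductance_set /edge_flow predS; apply.
  have r0 : 0 <= 2^-1 * g k / (1 - 2^-1 * g k) by rewrite divr_ge0 //; lra.
  have phi0 := le_trans (phi_ge0 k) le_phi.
  rewrite mulrA ler_pXn2r ?nnegrE; first by rewrite ler_wpM2l.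
  - by [].
  - exact: mulr_ge0.
  - exact: mulr_ge0.
(* If some S is admissible, [step] bounds a nonnegative sum by c k times a positive root; if none
   is, the conductance is 0 and c k = 1. *)
have c_ge0 k : 0 <= c k.
  have [[S SN S2]|noS] := pselect (exists2 S : {set 'I_n.+1},
      S != finset.set0 & mass (p k) S <= 2^-1).
    have [w [w0 _ wle]] := step k S SN S2.
    have a0 : 0 < Num.sqrt (mass (p k) S) by rewrite sqrtr_gt0 mass_gt0.
    rewrite -(pmulr_lge0 _ a0); apply: le_trans wle.
    by apply: sumr_ge0 => T _; rewrite mulr_ge0 ?sqrtr_ge0.
  rewrite /c (_ : conductance P k.+1%:Z = 0) ?mulr0 ?expr0n /= ?mulr0 ?subr0 //.
  rewrite /conductance inf_out // => -[[_ [S [SN S2] _]] _].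
  by apply: noS; exists S => //; move: S2; rewrite predS.
have C0 : 0 <= \prod_(0 <= j < t) c j by exact: prodr_ge0.
have bound := evolving_sets_bound dp c_ge0 step t 0%N.
apply: ge_sup; first by exists (tv_dist (fun y => transition P 0 t%:Z ord0 y)
  (target P t%:Z)), ord0.
move=> _ [x _ <-]; rewrite /tv_dist -(ler_pM2l (_ : 0 < 2 :> R)) //.
rewrite mulrA mulfV ?pnatr_eq0 // mul1r; apply: le_trans small.
have x0 : 0 < p 0%N x by exact: p_gt0.
have tmin0 : 0 < target_min P t%:Z by apply: min_val_gt0; exact: p_gt0.
have tmin1 : target_min P t%:Z <= 1.
  have [_ <-] := dp t; apply: (le_trans (min_val_le (target P t%:Z) ord0)).
  rewrite (bigD1 ord0) //= lerDl sumr_ge0 // => y _; exact/ltW/p_gt0.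
have omin0 : 0 < target_min P 0 by apply: min_val_gt0; exact: (p_gt0 0%N).
have prodE : \prod_(1 <= s < t.+1)
    (1 - 2^-1 * (2^-1 * (min_ratio P s%:Z / (1 - 2^-1 * min_ratio P s%:Z))
                   * conductance P s%:Z) ^+ 2) = \prod_(0 <= j < t) c j.
  by rewrite big_add1.
rewrite prodE.
have transE : transition P 0 t%:Z = \prod_(0 <= j < t) A j.
  rewrite /transition subr0 absz_nat.
  by apply: eq_bigr => k _; rewrite add0r.
have row_p d : (\row_y p 0%N y) *m \prod_(0 <= j < d) A j = \row_y p d y.
  elim: d => [|d IH]; first by rewrite big_geq // mulmx1.
  rewrite big_nat_recr //= -mulmxE mulmxA IH.
  by apply/rowP => y; rewrite !mxE pS; apply: eq_bigr => z _; rewrite mxE.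
(* A singleton start gives a multiple of delta_x - pi_0, which P^{0,t} sends to the same multiple of
   P^{0,t}(x,.) - pi_t. *)
have centeredE : centered (p 0%N) [set x]%SET =
    p 0%N x *: (delta_mx ord0 x - \row_y p 0%N y).
  apply/rowP => y; rewrite !mxE /mass big_set1 inE /=.
  by case: eqP => [->|_] /=; ring.
have normE : norm1 (centered (p 0%N) [set x]%SET *m \prod_(0 <= j < t) A j) =
    p 0%N x * \sum_y `|transition P 0 t%:Z x y - target P t%:Z y|.
  rewrite centeredE -scalemxAl mulmxBl row_p -rowE -transE norm1Z gtr0_norm //.
  by congr (_ * _); apply: eq_bigr => y _; rewrite !mxE.
have := bound [set x]%SET; rewrite add0n normE /mass big_set1.
set D := \sum_y _ => D_le.
have sx0 : 0 < Num.sqrt (p 0%N x) by rewrite sqrtr_gt0.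
(* Dividing p_0(x) D <= sqrt(p_0(x)) C by p_0(x), with C the product, leaves the factor
   p_0(x)^(-1/2). *)
apply: (@le_trans _ _ ((Num.sqrt (p 0%N x))^-1 * \prod_(0 <= j < t) c j)).
  rewrite [leRHS]mulrC ler_pdivlMr // -(ler_pM2r sx0) -mulrA -expr2.
  rewrite sqr_sqrtr ?(ltW x0) // [leLHS]mulrC.
  rewrite (le_trans D_le) // ler_wpM2l // ler_wsqrtr //.
  by rewrite ge_min lexx.
(* The minimum at time t is at most 1 and the one at time 0 at most p_0(x), so their product is at
   most p_0(x). *)
rewrite ler_wpM2r // lef_pV2 ?posrE ?sqrtr_gt0 ?mulr_gt0 //.
rewrite ler_wsqrtr // (le_trans (ler_wpM2r (ltW omin0) tmin1)) // mul1r.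
exact: (min_val_le (target P 0)).
Qed.
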